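(* Let $I$ be a compact interval and let $f : I \to I$ be a continuous map. Suppose $f$ has a periodic point of least period $m$, where $m \ge 3$ is odd. Then for every even positive integer $n$, $f$ has a periodic point of least period $n$. Furthermore, $f$ has a periodic point of least period $n$ for each integer $n$ with $n \ge m+1$.
   Context: For $n \ge 1$, $f^n$ denotes the $n$-fold iterate of $f$ (so $f^1 = f$, $f^n = f \circ f^{n-1}$ for $n \ge 2$). A point $y \in I$ is a periodic point of $f$ with least period $m$ if $f^m(y) = y$ and $f^i(y) \ne y$ for all $0 < i < m$. *)

(* Defs.v *)
(* MathComp / MathComp-Analysis *)
From HB Require Import structures.
From mathcomp Require Import all_boot all_order all_algebra.
From mathcomp Require Import all_classical all_reals all_analysis.
Set Implicit Arguments.
Unset Strict Implicit.
Unset Printing Implicit Defensive.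

Local Open Scope classical_set_scope.

(* The self-map of [I] is a total function [f] on the ambient type; only its
   values on [I] matter when [f] maps [I] into [I].  The condition [0 < m]
   excludes the degenerate [iter 0 f y = y]. *)
Definition least_period (T : Type) (I : set T) (f : T -> T) (m : nat) (y : T)
    : Prop :=
  [/\ (0 < m)%N, I y, iter m f y = y &
      forall i : nat, (0 < i < m)%N -> iter i f y <> y].

(* Main.v *)
Require Import Defs.
From HB Require Import structures.
From mathcomp Require Import all_boot all_order all_algebra.
From mathcomp Require Import all_classical all_reals all_analysis.
From mathcomp Require Import zify lra.
Set Implicit Arguments.
Unset Strict Implicit.
Unset Printing Implicit Defensive.
Import Order.TTheory GRing.Theory Num.Theory.
Import numFieldNormedType.Exports.
Local Open Scope classical_set_scope.
Local Open Scope ring_scope.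

(** The proof follows a few well-chosen orbits with the intermediate value theorem.

Replace [f] by a continuous map [F] of the whole line with [F >= A], where [A]
is the least point of the given orbit: precompose with the retraction onto
[`[A, b]] and cut the values off at [A].  Where the cut-off matters the orbit
passes through [A], so the only least period it can affect is [m] itself.

Let [c = iter m.-1 F A] be the point of the orbit sent to [A], let [F v = c]
with [A <= v < c] (such a [v] exists, for otherwise [`[A, c[] would be invariant
and the orbit of [A] would never reach [c]), and let [z] be the first fixed
point of [F] after [A].  If [z < v], then [z], [v] and a preimage of [z] beyond
[v] form a horseshoe for [F] and all periods occur
([horseshoe_periods_mirror]).

Otherwise [A < v < z], [F] lies above the diagonal on [`[A, z[], and the square
[g] of [F] sends [v] to [A] and fixes [z].  Since [m] is odd, [c] lies on the
[g]-orbit of [A], so that this orbit jumps over [z]: its last point [d] to the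
left of [v] never returns there.  Cutting [g] off at [z], one gets a horseshoe
on [`[d, v]], hence points of every least period [n] for [g] with their whole
[g]-orbits in [`[A, z[] ([squared_periods]).  Their period for [F] is [2 n]: if
it were odd, the [F]-orbit would be the [g]-orbit and would lie in a region
where [F] increases every point ([even_periods]).

For odd [n >= m + 2], write [n = m + 2 + 2 j].  To the right of [v], [g] pushes
points to the left, away from its first fixed point [z1] beyond [v].  There is a
fixed point [y] of [iter n F] whose orbit makes [j] such leftward steps of [g]
without passing [v] and is brought back to [y] by the remaining [m + 2] steps of
[F]: on the one hand these steps send [v] to [A], to the left of everything; on
the other hand they send a preimage under [g] of a [g]-fixed point beyond [z]
([odd_periods]).  As [g] moves [y] strictly to the left [j + 1] times, the least
period [k] of [y] exceeds [j + 1]; as [k] divides [n], either [k = n] or [k] is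
an odd period at least [3] and less than [m], and strong induction on [m]
concludes. *)

(** * Intermediate values and first fixed points *)

Lemma continuous_iter (T : topologicalType) (g : T -> T) (n : nat) :
  continuous g -> continuous (iter n g).
Proof.
move=> cg; elim: n => [|n IH] x; first exact: cvg_id.
exact: (continuous_comp (IH x) (cg _)).
Qed.

Section IntermediateValues.
Context {R : realType}.
Implicit Types (phi : R -> R) (p q v x : R).

Lemma ivt_rising phi p q v : continuous phi -> p <= q ->
  phi p <= v <= phi q -> exists2 x, p <= x <= q & phi x = v.
Proof.
move=> cphi pq /andP[pv vq].
have [|x xpq <-] := IVT pq (continuous_subspaceT cphi) (v := v).
  by rewrite ge_min pv le_max vq orbT.
by exists x => //; move: xpq; rewrite in_itv.
Qed.

Lemma ivt_falling phi p q v : continuous phi -> p <= q ->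
  phi q <= v <= phi p -> exists2 x, p <= x <= q & phi x = v.
Proof.
move=> cphi pq /andP[qv vp].
have [|x xpq <-] := IVT pq (continuous_subspaceT cphi) (v := v).
  by rewrite ge_min qv orbT le_max vp.
by exists x => //; move: xpq; rewrite in_itv.
Qed.

(** The set where [phi <= 0] on the segment is closed, so it has a least element. *)
Lemma first_zero phi p q : continuous phi -> p <= q ->
  0 < phi p -> phi q <= 0 ->
  exists c, [/\ p < c, c <= q, phi c = 0 &
    forall x, p <= x -> x < c -> 0 < phi x].
Proof.
move=> cphi pq phip phiq.
(* The least element is minus the supremum of the reflected set. *)
pose S := [set x | p <= - x <= q] `&` ((fun x => phi (- x)) @^-1` [set y | y <= 0]).
have clS : closed S.
  apply: closedI.
    have -> : [set x | p <= - x <= q] = [set` `[- q, - p]].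
      by apply/seteqP; split=> x /=; rewrite in_itv /= => /andP[? ?];
        apply/andP; split; lra.
    exact: itv_closed.
  apply: preimage_closed; last exact: closed_le.
  move=> x _; apply: (continuous_comp (g := phi)); last exact: cphi.
  exact: opp_continuous.
have S0 : S !=set0 by exists (- q); split; rewrite /= opprK // pq lexx.
have Sub : has_ubound S.
  by exists (- p) => x [/= /andP[? ?] _]; rewrite lerNr.
have := closure_sup S0 Sub.
rewrite -(closure_id S).1 //; set s := sup S => -[/= /andP[ps sq] phis].
have lt_pos x : p <= x -> x < - s -> 0 < phi x.
  move=> px xs; rewrite ltNge; apply/negP => phix.
  have : - x <= s.
    apply: ub_le_sup => //; split; rewrite /= opprK // px /=.
    by rewrite (le_trans (ltW xs)).
  by lra.
have [x /andP[px xs] phix] : exists2 x, p <= x <= - s & phi x = 0.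
  by apply: ivt_falling => //; rewrite phis ltW.
have xE : x = - s.
  by apply/eqP; rewrite eq_le xs leNgt; apply/negP => /(lt_pos _ px); rewrite phix ltxx.
exists (- s); split => //; last by rewrite -xE.
rewrite lt_neqAle ps andbT; apply/eqP => psE.
by move: phis; rewrite -psE leNgt phip.
Qed.

Lemma first_fixed_point_above g p q : continuous g -> p <= q ->
  p < g p -> g q <= q ->
  exists c, [/\ p < c, c <= q, g c = c & forall x, p <= x -> x < c -> x < g x].
Proof.
move=> cg pq gp gq.
have [||||c [pc cq gc lc]] := @first_zero (fun x => g x - x) p q => //.
- by move=> x; apply: cvgB; [exact: cg | exact: cvg_id].
- by rewrite subr_gt0.
- by rewrite subr_le0.
exists c; split => //; first by apply/eqP; rewrite -subr_eq0 gc.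
by move=> x px xc; rewrite -subr_gt0 lc.
Qed.

Lemma first_fixed_point_below g p q : continuous g -> p <= q ->
  g p < p -> q <= g q ->
  exists c, [/\ p < c, c <= q, g c = c & forall x, p <= x -> x < c -> g x < x].
Proof.
move=> cg pq gp gq.
have [||||c [pc cq gc lc]] := @first_zero (fun x => x - g x) p q => //.
- by move=> x; apply: cvgB; [exact: cvg_id | exact: cg].
- by rewrite subr_gt0.
- by rewrite subr_le0.
exists c; split => //; first by apply/eqP; rewrite eq_sym -subr_eq0 gc.
by move=> x px xc; rewrite -subr_gt0 lc.
Qed.

(** * Horseshoes *)

(** The first fixed points [c_n] of [iter n g] after [d] decrease strictly:
[iter n g] falls from at least [v] at [d] to [c_n < v] at [c_n], so it takes the
value [v] at some [x < c_n], and then [iter n.+1 g x = g v <= d], which forces a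
fixed point of [iter n.+1 g] before [x].  Hence [c_n] is fixed by no earlier
iterate. *)
Lemma horseshoe_periods g d v : continuous g -> d < v ->
  (forall n, (0 < n)%N -> v <= iter n g d) -> g v <= d ->
  forall n, (0 < n)%N ->
    exists2 c, d < c < v & least_period [set: R] g n c.
Proof.
move=> cg dv gd gv.
(* For [k < n] the strict inequality extends to [c] itself: this is what makes
[n] its least period. *)
have fpt n : (0 < n)%N -> exists c, [/\ d < c, c < v, iter n g c = c,
    forall x, d <= x -> x < c -> x < iter n g x &
    forall k, (0 < k < n)%N -> forall x, d <= x -> x <= c -> x < iter k g x].
  elim: n => // -[_ _|n IH _].
    have [|||c [dc cv gc lc]] := @first_fixed_point_above g d v _ (ltW dv) => //.
    - by apply: lt_le_trans dv _; exact: (gd 1%N).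
    - by apply: le_trans gv (ltW dv).
    exists c; split => //; last by move=> [|[|k]].
    rewrite lt_neqAle cv andbT; apply/eqP => cvE.
    by move: gv; rewrite -cvE gc leNgt dc.
  have [//|c [dc cv gc lc lkc]] := IH.
  have [||x /andP[dx xc] gx] := @ivt_falling (iter n.+1 g) d c v _ (ltW dc).
  - exact: continuous_iter.
  - by apply/andP; split; [rewrite gc ltW | exact: gd].
  have [||||c' [dc' c'x gc' lc']] := @first_fixed_point_above (iter n.+2 g) d x => //.
  - exact: continuous_iter.
  - by apply: lt_le_trans dv _; exact: gd.
  - by rewrite iterS gx (le_trans gv).
  have xc' : x < c.
    rewrite lt_neqAle xc andbT; apply/eqP => xE.
    by move: cv; rewrite -gc -xE gx ltxx.
  have c'c : c' < c by apply: le_lt_trans c'x _.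
  exists c'; split => //; first by apply: lt_trans c'c cv.
  move=> k /andP[k0]; rewrite ltnS leq_eqVlt => /orP[/eqP -> //|kn] y dy yc'.
    by apply: lc => //; apply: le_lt_trans yc' c'c.
  apply: lkc => //; first by rewrite k0.
  by apply: le_trans yc' (ltW _).
move=> n n0; have [//|c [dc cv gc _ lkc]] := fpt n.
exists c; first by rewrite dc.
by split=> // k /lkc /(_ c (ltW dc) (lexx _)) lt_c ck; rewrite ck ltxx in lt_c.
Qed.

Lemma iter_conjN g n x : iter n (fun y => - g (- y)) x = - iter n g (- x).
Proof.
by elim: n => [|n IH]; [rewrite /= opprK | rewrite !iterS IH opprK].
Qed.

(** The reflection [x |-> - x] exchanges left and right and preserves periods. *)
Lemma horseshoe_periods_mirror g d v : continuous g -> v < d ->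
  (forall n, (0 < n)%N -> iter n g d <= v) -> d <= g v ->
  forall n, (0 < n)%N -> exists c, least_period [set: R] g n c.
Proof.
move=> cg vd gd gv n n0.
have [||||//|c _ [_ _ cn ci]] := @horseshoe_periods (fun y => - g (- y)) (- d) (- v) _ _ _ _ n.
- move=> x; apply: continuous_comp; last exact: opp_continuous.
  by apply: (continuous_comp (g := g)); [exact: opp_continuous | exact: cg].
- by rewrite ltrN2.
- by move=> k k0; rewrite iter_conjN opprK lerN2 gd.
- by rewrite opprK lerN2.
exists (- c); split=> //; first by rewrite -{2}cn iter_conjN opprK.
by move=> i /ci; rewrite iter_conjN => ne E; apply: ne; rewrite E opprK.
Qed.


End IntermediateValues.

(** * Iterates and periods *)

Lemma fixed_least_period (T : Type) (f : T -> T) (n : nat) (y : T) :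
  (0 < n)%N -> iter n f y = y ->
  exists2 k, least_period [set: T] f k y & (k %| n)%N.
Proof.
move=> n0 fn.
have ex : exists k, (0 < k)%N && `[< iter k f y = y >].
  by exists n; rewrite n0; apply/asboolP.
case: (ex_minnP ex) => k /andP[k0 /asboolP fk] kmin.
exists k.
  split=> // i /andP[i0 ik] fi.
  by have := kmin i; rewrite i0 leqNgt ik => /(_ _); rewrite asboolT // => /(_ isT).
have fr : iter (n %% k) f y = y.
  rewrite -{2}fn {2}(divn_eq n k) addnC iterD iterM.
  by rewrite (iter_fix _ fk).
rewrite /dvdn; case: posnP => // r0.
have := kmin (n %% k)%N; rewrite r0 asboolT // => /(_ isT).
by rewrite leqNgt ltn_mod k0.
Qed.

Lemma iter_comp2 (T : Type) (f : T -> T) n x :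
  iter n (fun y => f (f y)) x = iter n.*2 f x.
Proof. by elim: n => // n IH; rewrite doubleS !iterS IH. Qed.

Lemma iter_add_period (T : Type) (f : T -> T) m i x :
  iter m f x = x -> iter (m + i) f x = iter i f x.
Proof. by move=> fm; rewrite addnC iterD fm. Qed.

(** * Orbits of the square below the first fixed point *)

Section TurningPoint.
Context {R : realType} (F : R -> R) (A v z : R).
Context (cF : continuous F) (geA : forall x, A <= F x).
Context (Av : A < v) (vz : v < z) (FFv : F (F v) = A) (Fz : F z = z).
Context (ltF : forall x, A <= x -> x < z -> x < F x).

Let g x := F (F x).
(* Orbits of [h] that reach [z] stay there, so a periodic orbit of [h] that
starts below [z] never feels the cut-off. *)
Let h x := Num.min (g x) z.

Let cg : continuous g.
Proof. by move=> x; apply: (continuous_comp (f := F) (g := F)); exact: cF. Qed.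

Let ch : continuous h.
Proof. by move=> x; apply: (@continuous_min R R g (cst z) x (@cg x)); exact: cvg_cst. Qed.

Let hz : h z = z. Proof. by rewrite /h /g !Fz minxx. Qed.

Let h_le n x : x <= z -> iter n h x <= z.
Proof. by case: n => // n _; rewrite iterS /h ge_min lexx orbT. Qed.

Let h_ge n x : A <= x -> A <= iter n h x.
Proof.
by case: n => // n _; rewrite iterS /h le_min geA /= (ltW (lt_trans Av vz)).
Qed.

Let h_g n x : x <= z -> iter n h x < z -> iter n h x = iter n g x.
Proof.
move=> xz; elim: n => // n IH; rewrite !iterS.
have := h_le n xz; rewrite le_eqVlt => /orP[/eqP -> | /IH ->].
  by rewrite hz ltxx.
by rewrite /h gt_min ltxx orbF => /ltW/min_idPl.
Qed.

(** The orbit of [A] under [h] ends at [z], so it visits the part to the left of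
[v] a last time. *)
Let last_visit l : z < iter l g A ->
  exists2 d, A <= d < v & forall n, (0 < n)%N -> v < iter n h d.
Proof.
move=> zl.
have Az : A <= z by rewrite ltW // (lt_trans Av).
have hl : iter l h A = z.
  apply/eqP; move: (h_le l Az); rewrite le_eqVlt => /orP[//|lz].
  by move: (lz); rewrite (h_g Az lz) => /(lt_trans zl); rewrite ltxx.
have late i : (l <= i)%N -> iter i h A = z.
  by move=> li; rewrite -(subnK li) iterD hl iter_fix.
have ex : exists i, iter i h A <= v by exists 0%N; exact: ltW.
have ub i : iter i h A <= v -> (i <= l)%N.
  by move=> iv; rewrite leqNgt; apply/negP => /ltnW/late E; move: iv; rewrite E leNgt vz.
case: (ex_maxnP ex ub) => i iv imax.
have far n : (0 < n)%N -> v < iter n h (iter i h A).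
  move=> n0; rewrite ltNge -iterD; apply/negP => /imax.
  by rewrite -{2}[i]add0n leq_add2r leqNgt n0.
exists (iter i h A) => //; rewrite h_ge //= lt_neqAle iv andbT.
apply/eqP => dv; have := far 1%N isT; rewrite dv /= /h /g FFv.
by rewrite lt_min => /andP[/(lt_trans Av)]; rewrite ltxx.
Qed.

(** The last visit [d] and [v] form a horseshoe for [h], because
[h v = A <= d]. *)
Lemma squared_periods l n : z < iter l g A -> (0 < n)%N ->
  exists2 c, A < c < v & least_period [set: R] g n c /\
    forall i, A <= iter i g c < z.
Proof.
move=> zl n0; have [d /andP[Ad dv] hd] := last_visit zl.
have [||c /andP[dc cv] [_ _ hc ci]] := horseshoe_periods ch dv _ _ n0.
- by move=> k /hd/ltW.
- by rewrite /h /g FFv ge_min Ad.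
have cz : c < z by apply: lt_trans vz.
have Ac : A < c by apply: le_lt_trans dc.
have lt_z i : iter i h c < z.
  rewrite lt_neqAle h_le ?ltW // andbT; apply/eqP => hi.
  have : iter (n * i) h c = z.
    by rewrite -(subnK (leq_pmull i n0)) iterD hi iter_fix.
  by rewrite mulnC iterM iter_fix // => cE; rewrite cE ltxx in cz.
have hE i : iter i h c = iter i g c by apply: h_g => //; exact: ltW.
exists c; first by rewrite Ac.
split; last by move=> i; rewrite -hE lt_z h_ge // ltW.
by split=> // [|i]; rewrite -hE // => /ci.
Qed.

Lemma no_orbit_below c k : (0 < k)%N -> iter k F c = c ->
  ~ (forall i, A <= iter i F c < z).
Proof.
move=> k0 Fk low.
have lt_c i : (0 < i)%N -> c < iter i F c.
  elim: i => // -[_ _|i IH _]; first by have /andP[] := low 0%N; exact: ltF.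
  apply: lt_trans (IH isT) _; rewrite (iterS i.+1).
  by have /andP[] := low i.+1; exact: ltF.
by have := lt_c k k0; rewrite Fk ltxx.
Qed.

(** A point of least period [n./2] for [g] can fail to have least period [n] for
[F] only by having an odd period [k].  Shifting by [k] then turns the odd
iterates into even ones, so the whole [F]-orbit stays below [z], against
[no_orbit_below]. *)
Lemma even_periods l n : z < iter l g A -> (0 < n)%N -> ~~ odd n ->
  exists c, least_period [set: R] F n c.
Proof.
move=> zl n0 nev.
have nE : n = n./2.*2 by rewrite even_halfK.
have [|c _ [[_ _ gc ci] low]] := @squared_periods l n./2 zl; first by lia.
exists c; split=> //; first by rewrite nE -iter_comp2.
move=> k /andP[k0 kn] Fk.
case: (boolP (odd k)) => kodd; last first.
  apply: (ci k./2); first by lia.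
  by rewrite [LHS]iter_comp2 even_halfK.
apply: (no_orbit_below k0 Fk) => i.
case: (boolP (odd i)) => iodd.
  rewrite -(iter_add_period i Fk).
  have -> : (k + i = ((k + i)./2).*2)%N by rewrite even_halfK // oddD kodd iodd.
  by rewrite -iter_comp2.
by rewrite -(even_halfK iodd) -iter_comp2.
Qed.

(** The point sought is fixed by [Phi], which is [iter (m + 2) F] after [j] steps
of the map [G] obtained from [g] by cutting off at [v] from below.  At [v],
[Phi] takes the value [A < v].  To find a point where [Phi] is above the
diagonal, take the [g]-fixed point [c1 < v]: its odd iterates all equal
[F c1 > z], and some point of [`[v, z1]] reaches [c1] after [j] steps of [G] and
one of [g].  If the [G]-orbit of a fixed point of [Phi] met [v] within [j]
steps it would stay there, and [Phi] would send the point to [A]; so these steps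
are steps of [g].  The alternative [k < m] in the conclusion stems from [k <= n / 3]
combined with [j + 2 <= k]. *)
Lemma odd_periods m l n : z < iter l g A -> odd m -> iter m F A = A ->
  odd n -> (m + 2 <= n)%N ->
  exists k c, [/\ least_period [set: R] F k c, odd k, (3 <= k)%N &
    k = n \/ (k < m)%N].
Proof.
move=> zl modd Fm nodd mn.
have [c1 /andP[Ac1 c1v] [[_ _ gc1 _] _]] := squared_periods zl (ltn0Sn 0).
rewrite /= in gc1.
have Fodd i : odd i -> iter i F c1 = F c1.
  move=> iodd; rewrite -(odd_double_half i) iodd iterS -iter_comp2.
  by rewrite iter_fix.
have Fc1 : z < F c1.
  have [//|Fz1|Fz1] := ltgtP z (F c1).
    have c1F : c1 < F c1 by apply: ltF; [exact: ltW | exact: lt_trans vz].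
    by have := ltF (geA c1) Fz1; rewrite -/(g c1) gc1 => /(lt_trans c1F); rewrite ltxx.
  by move: (lt_trans c1v vz); rewrite -gc1 /g -Fz1 Fz ltxx.
have [||z1 [vz1 z1z gz1 ltg]] := @first_fixed_point_below _ g v z cg (ltW vz).
- by rewrite /g FFv.
- by rewrite /g !Fz.
have [|w /andP[vw wz1] gw] := @ivt_rising _ g v z1 c1 cg (ltW vz1).
  by rewrite gz1 /g FFv (ltW Ac1) (ltW (lt_trans c1v vz1)).
pose G x := Num.max v (g x).
pose j := ((n - m - 2)./2)%N.
have nE : n = (m + 2 + j.*2)%N.
  by rewrite /j; clear -nodd modd mn; lia.
have cG : continuous G.
  by move=> x; apply: (@continuous_max R R (cst v) g x _ (@cg x)); exact: cvg_cst.
have Gv : G v = v by apply: max_l; rewrite /g FFv ltW.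
have Gz1 : G z1 = z1 by rewrite /G gz1; exact/max_r/ltW.
(* [G] fixes both [v] and [z1], so its iterates cover the segment. *)
have [|u /andP[vu uz1] Gu] :=
    @ivt_rising _ (iter j G) v z1 w (continuous_iter cG) (ltW vz1).
  by rewrite !iter_fix // vw.
pose Phi x := iter (m + 2) F (iter j G x).
have cPhi : continuous Phi.
  move=> x; apply: (continuous_comp (f := iter j G) (g := iter (m + 2) F));
    exact: continuous_iter.
have Phiu : u < Phi u.
  rewrite /Phi Gu iterD /= -/(g w) gw Fodd //.
  by apply: le_lt_trans Fc1; apply: le_trans z1z.
have [|y [vy yu Phiy _]] := first_fixed_point_below cPhi vu _ (ltW Phiu).
  by rewrite /Phi (iter_fix _ Gv) iterD /= FFv Fm.
have yz1 : y < z1.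
  apply: lt_le_trans uz1; rewrite lt_neqAle yu andbT; apply/eqP => yE.
  by move: Phiu; rewrite -yE Phiy ltxx.
have Gy i : (i <= j)%N -> iter i G y != v.
  move=> ij; apply/eqP => Giv.
  have Gjv : iter j G y = v by rewrite -(subnK ij) iterD Giv (iter_fix _ Gv).
  move: Phiy; rewrite /Phi Gjv iterD /= FFv Fm => yA.
  by move: (lt_trans Av vy); rewrite -yA ltxx.
have spiral i : (i <= j)%N ->
    [/\ iter i G y = iter i g y, v < iter i g y & iter i g y <= y].
  elim: i => [//|i IH] ij; have [GE vgi giy] := IH (ltnW ij).
  have gG : iter i.+1 G y = Num.max v (g (iter i g y)) by rewrite iterS GE.
  have vg : v < g (iter i g y).
    have := Gy _ ij; rewrite gG.
    by case: (leP (g (iter i g y)) v) => //; rewrite eqxx.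
  split=> //; first by rewrite gG iterS; exact/max_r/ltW.
  by rewrite iterS (le_trans (ltW (ltg _ (ltW vgi) _))) // (le_lt_trans giy).
have decr i : (0 < i <= j.+1)%N -> iter i g y < y.
  case: i => // i /= ij; have [_ vgi giy] := spiral i ij.
  by apply: lt_le_trans (ltg _ (ltW vgi) (le_lt_trans giy yz1)) giy.
have Fy : iter n F y = y.
  have [GE _ _] := spiral j (leqnn j).
  by rewrite nE iterD -iter_comp2 -[LHS]/(iter (m + 2) F (iter j g y)) -GE.
have n0 : (0 < n)%N by rewrite nE !addnS.
have [k yk kn] := fixed_least_period n0 Fy.
have kj : (j.+1 < k)%N.
  case: yk => k0 _ Fk _; rewrite ltnNge; apply/negP => kj.
  have := decr k; rewrite k0 kj iter_comp2 -addnn iterD !Fk ltxx.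
  by move=> /(_ isT).
have kodd : odd k := dvdn_odd kn nodd.
clear -nodd kodd kj kn nE yk.
exists k, y; split=> //; first by lia.
(* [n = q * k] with [q] odd; [q >= 3] gives [3 k <= m + 2 + 2 j <= m + 2 k - 2]. *)
move/dvdnP: kn => [[|[|[|q]]] nq]; [lia | by left; lia | | right].
- by move: nodd; rewrite nq oddM.
- by move: nE nq kj; nia.
Qed.

End TurningPoint.

(** * Maps with an odd cycle *)

(** The cases are those of the position of [v], a preimage of the point [b] that
is mapped to the least point [A] of the cycle, relative to the first fixed
point [z].  The oddness of [m] enters in that [b] is an iterate of [A] under the
square of [F], and in that [v] differs from [A]: otherwise [A] would have
period 2 besides the odd period [m], hence be fixed. *)
Lemma odd_orbit_periods (R : realType) (F : R -> R) (A : R) (m n : nat) :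
  continuous F -> (forall x, A <= F x) -> odd m -> iter m F A = A ->
  F A <> A -> (0 < n)%N -> ~~ odd n || (m < n)%N ->
  exists k c, least_period [set: R] F k c /\
    (k = n \/ [/\ odd k, (3 <= k)%N & (k < m)%N]).
Proof.
move=> cF geA modd Fm FA n0 nm.
pose l := m./2; pose b := iter l.*2 F A.
have mE : m = l.*2.+1 by rewrite -(odd_double_half m) modd.
have Fb : F b = A by rewrite -iterS -mE.
have AFA : A < F A by rewrite lt_neqAle geA andbT; apply/eqP => /esym.
have Ab : A < b.
  rewrite lt_neqAle; apply/andP; split; first by apply/eqP => bE; apply: FA; rewrite {1}bE.
  by rewrite /b; case: l.*2 => [|i]; [exact: lexx | exact: geA].
have [v /andP[Av vb] Fv] : exists2 v, A <= v <= b & F v = b.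
  apply: contrapT => nov.
  have ltb x : A <= x <= b -> F x < b.
    move=> /andP[Ax xb]; rewrite ltNge; apply/negP => bF.
    have [|v /andP[xv vb] Fv] := ivt_falling cF xb (v := b).
      by rewrite Fb ltW.
    by apply: nov; exists v => //; rewrite (le_trans Ax).
  have orb i : A <= iter i F A < b.
    elim: i => [|i /andP[Ai ib]]; first by rewrite lexx.
    by rewrite iterS geA ltb // Ai ltW.
  by have /andP[_] := orb l.*2; rewrite ltxx.
have [|z [Az zb Fz ltF]] := first_fixed_point_above cF (ltW Ab) AFA.
  by rewrite Fb ltW.
have zltb : z < b.
  rewrite lt_neqAle zb andbT; apply/eqP => zE.
  by move: Az; rewrite -Fz zE Fb ltxx.
have [vz|zv|vzE] := ltgtP v z; last by move: zltb; rewrite -Fz -vzE Fv ltxx.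
- have Altv : A < v.
    rewrite lt_neqAle Av andbT; apply/eqP => vE; apply: FA.
    by rewrite -{2}Fm mE iterS -iter_comp2 iter_fix // vE Fv Fb -vE.
  have FFv : F (F v) = A by rewrite Fv.
  have zl : z < iter l (fun x => F (F x)) A by rewrite iter_comp2.
  case: (boolP (odd n)) nm => nodd /= nm.
    have mn2 : (m + 2 <= n)%N by clear -modd nodd nm; lia.
    have [k [c [ck kodd k3 kn]]] :=
      odd_periods cF geA Altv vz FFv Fz ltF zl modd Fm nodd mn2.
    by exists k, c; split=> //; case: kn => [|km]; [left | right].
  have [c cn] := even_periods cF geA Altv vz FFv Fz ltF zl n0 nodd.
  by exists n, c; split=> //; left.
- have [|d /andP[vd db] Fd] := ivt_falling cF vb (v := z).
    by rewrite Fb Fv !ltW.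
  have vltd : v < d.
    rewrite lt_neqAle vd andbT; apply/eqP => dE.
    by move: zltb; rewrite -Fd -dE Fv ltxx.
  have [||c cn] := horseshoe_periods_mirror cF vltd _ _ n0.
  + by move=> [//|i] _; rewrite iterSr Fd iter_fix // ltW.
  + by rewrite Fv.
  by exists n, c; split=> //; left.
Qed.

Lemma continuous_comp_within (R : realType) (T : topologicalType) (D : set R)
    (k : T -> R) (f : R -> R) :
  continuous k -> (forall x, D (k x)) -> {within D, continuous f} ->
  continuous (f \o k).
Proof.
move=> ck kD cf x.
apply: (@continuous_comp T (subspace D) R k f); last exact: cf.
move=> U UkD; have {UkD} : within D (nbhs (k x)) U by rewrite nbhs_subspace_in.
move=> /(ck x); rewrite /nbhs /=; apply: filterS => y; exact.
Qed.

Lemma orbit_min (R : realType) (f : R -> R) (m : nat) (y : R) :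
  (0 < m)%N -> iter m f y = y ->
  exists2 j, (j < m)%N & forall i, iter j f y <= iter i f y.
Proof.
case: m => // m _ fm.
case: (@arg_minP _ R _ (ord0 : 'I_m.+1) xpredT (fun i => iter i f y)) => // j _ jmin.
exists j => // i; rewrite (divn_eq i m.+1) addnC iterD iterM (iter_fix _ fm).
by have := jmin (Ordinal (ltn_pmod i (ltn0Sn m))) isT.
Qed.

Lemma least_period_iter (T : Type) (I : set T) (f : T -> T) m y j :
  set_fun I I f -> least_period I f m y -> (j < m)%N ->
  least_period I f m (iter j f y).
Proof.
move=> fI [m0 Iy fm fi] jm; split=> //.
- by elim: j {jm} => // j IH; exact: fI.
- by rewrite -iterD addnC iterD fm.
move=> i im E; apply: (fi i im).
have yE : y = iter (m - j) f (iter j f y) by rewrite -iterD subnK // ltnW.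
by rewrite {1}yE -iterD addnC iterD E -yE.
Qed.

Theorem proposition5 (R : realType) (a b : R) (hab : a <= b) (f : R -> R)
    (hcont : {within `[a, b], continuous f})
    (hmap : set_fun `[a, b] `[a, b] f)
    (m : nat) (hm3 : (3 <= m)%N) (hmodd : odd m)
    (hper : exists y : R, least_period `[a, b] f m y) :
  (forall n : nat, (0 < n)%N -> ~~ odd n ->
     exists y : R, least_period `[a, b] f n y) /\
  (forall n : nat, (m + 1 <= n)%N ->
     exists y : R, least_period `[a, b] f n y).
Proof.
suff main n : (0 < n)%N -> ~~ odd n || (m < n)%N ->
    exists y, least_period `[a, b] f n y.
  split=> n; first by move=> n0 nev; apply: main; rewrite ?nev.
  rewrite addn1 => mn; apply: main; last by rewrite mn orbT.
  exact: leq_ltn_trans mn.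
move=> n0; elim/ltn_ind: m hm3 hmodd hper => m IH m3 modd.
move=> [y yper] nm.
have [m0 _ ym _] := yper.
have [j jm jmin] := orbit_min m0 ym.
have := least_period_iter hmap yper jm.
set A := iter j f y => -[_ /[dup] IA]; rewrite /= in_itv /= => /andP[aA Ab] fmA fiA.
have geA i : A <= iter i f A by rewrite -iterD.
(* The values of [f] do not exceed [b], so only the cut-off at [A] is felt. *)
pose clamp x := Num.max A (Num.min x b).
pose F x := Num.max A (f (clamp x)).
have clamp_itv x : A <= clamp x <= b.
  by rewrite /clamp le_max lexx ge_max Ab ge_min lexx orbT.
have clampE x : A <= x <= b -> clamp x = x.
  by move=> /andP[Ax xb]; rewrite /clamp (min_l xb) max_r.
have I_of x : A <= x <= b -> [set` `[a, b]] x.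
  by move=> /andP[Ax xb]; rewrite /= in_itv /= (le_trans aA Ax).
have cF : continuous F.
  have cclamp : continuous clamp.
    move=> x; apply: (@continuous_max R R (cst A) (Num.min^~ b)); first exact: cvg_cst.
    by apply: (@continuous_min R R id (cst b)); [exact: cvg_id | exact: cvg_cst].
  have cfk := continuous_comp_within cclamp (fun x => I_of _ (clamp_itv x)) hcont.
  by move=> x; apply: (@continuous_max R R (cst A) _ x _ (@cfk x)); exact: cvg_cst.
have F_itv x : A <= F x <= b.
  have := hmap _ (I_of _ (clamp_itv x)); rewrite /= in_itv /= => /andP[_ fb].
  by rewrite /F le_max lexx ge_max Ab.
have FA i : iter i F A = iter i f A.
  elim: i => // i IHi; rewrite !iterS IHi /F clampE ?max_r //; first exact: (geA i.+1).
  by rewrite geA /= -IHi; case: i {IHi} => //= i; have /andP[] := F_itv (iter i F A).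
have F1A : F A <> A by have := FA 1%N => /= ->; apply: (fiA 1%N); exact: ltnW.
have FmA : iter m F A = A by rewrite FA.
have Fge x : A <= F x by have /andP[] := F_itv x.
(* An [F]-orbit that avoids [A] is an [f]-orbit, and the orbit of [A] has least
period [m]. *)
have transfer k c : k <> m -> least_period [set: R] F k c -> least_period `[a, b] f k c.
  move=> km [k0 _ Fk Fi].
  have c_itv i : A <= iter i F c <= b.
    by rewrite -Fk -iterD -(prednK k0) addnS iterS; exact: F_itv.
  have offA i : iter i F c <> A.
    move=> ciA; apply: km.
    have AE : iter k F A = A by rewrite -ciA -iterD addnC iterD Fk.
    have cE : c = iter (k * i - i) F A.
      rewrite -ciA -iterD subnK ?leq_pmull //.
      by rewrite mulnC iterM iter_fix.
    apply/eqP; rewrite eqn_leq; apply/andP; split; rewrite leqNgt; apply/negP => lt.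
      apply: (Fi m); first by rewrite m0.
      by rewrite cE -iterD addnC iterD FmA.
    by apply: (fiA k); [rewrite k0 | rewrite -FA].
  have fE i : iter i f c = iter i F c.
    elim: i => // i IHi; rewrite !iterS IHi /F clampE //.
    have := offA i.+1; rewrite iterS /F clampE // => ne.
    by case: (leP A (f (iter i F c))) ne.
  split=> // [||i]; [exact: (I_of _ (c_itv 0%N)) | by rewrite fE | by rewrite fE; exact: Fi].
have [k [c [ck kn]]] := odd_orbit_periods cF Fge modd FmA F1A n0 nm.
have nm' : n <> m by move=> nE; move: nm; rewrite nE modd ltnn.
case: kn => [kE|[kodd k3 km]].
  by exists c; apply: transfer; rewrite -kE // kE.
apply: (IH k km k3 kodd).
  by exists c; apply: transfer => // kE; rewrite kE ltnn in km.
by case/orP: nm => [-> //|mn]; rewrite (ltn_trans km mn) orbT.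
Qed.
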